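(* Let $\mathbf{H}$ be an algebraic torus defined over $\mathbb{Q}$, let $L$ be its splitting field, let $\mathcal{O}$ be the ring of integers of $L$ and $\mathcal{P}$ the set of nonzero prime ideals of $\mathcal{O}$. Let $n>0$ be an integer and let $S\subset\mathcal{P}$ be the set of prime ideals $\pi\in\mathcal{P}$ dividing $n$ (i.e. $n\in\pi$). Then there exists $h\in\mathbf{H}(\mathbb{Q})$ such that (i) $\chi(h)$ is not an algebraic integer for any non-trivial character $\chi\in X(\mathbf{H})$, and (ii) $\chi(h)\equiv 1 \mod n\mathcal{O}_\pi$ for any $\chi\in X(\mathbf{H})$ and any $\pi\in S$.
   Context: $X(\mathbf{H})$ denotes the group of characters of $\mathbf{H}$ (defined over $\overline{\mathbb{Q}}$), a $\mathrm{Gal}(\overline{\mathbb{Q}}/\mathbb{Q})$-module isomorphic to $\mathbb{Z}^{\dim \mathbf{H}}$. The splitting field of $\mathbf{H}$ is the smallest Galois extension $L$ of $\mathbb{Q}$ such that $\mathrm{Gal}(\overline{\mathbb{Q}}/L)$ acts trivially on $X(\mathbf{H})$; for $h\in\mathbf{H}(\mathbb{Q})$ and $\chi\in X(\mathbf{H})$ one has $\chi(h)\in L^*$. For $\pi\in\mathcal{P}$, $\mathcal{O}_\pi$ and $L_\pi$ are the $\pi$-adic completions of $\mathcal{O}$ and $L$; for $x,y\in L$, ''$x\equiv y \mod n\mathcal{O}_\pi$'' means that the images $x_\pi,y_\pi$ of $x,y$ in $L_\pi$ satisfy $x_\pi-y_\pi\in n\mathcal{O}_\pi$. *)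

(* Defs.v *)
From HB Require Import structures.
From mathcomp Require Import all_boot all_order all_algebra all_fingroup all_field.
Set Implicit Arguments. Unset Strict Implicit. Unset Printing Implicit Defensive.
Import GRing.Theory Num.Theory.
Local Open Scope ring_scope.

(* Model of an algebraic Q-torus H of dimension d split by the number field L
   (a finite Galois extension of Q, given as a splittingFieldType over rat):
   - the character group X(H) is 'rV[int]_d (row vectors, written additively);
   - Gal(L/Q) = gal_of {:L}; mathcomp composes Galois elements as
     (s * t) a = t (s a), i.e. they act on the right; accordingly
     Gal(L/Q) acts on X(H) on the right by  chi |-> chi *m rho s,
     where rho is a group morphism into GL_d(Z);
   - L is the splitting field: rho is faithful (the kernel of the action is
     exactly Gal(Lbar/L));
   - H(Q) = Galois-equivariant homomorphisms X(H) -> L^*, and chi(h) = h chi. *)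

Definition gal_rep (L : splittingFieldType rat) (d : nat)
  (rho : gal_of {:L} -> 'M[int]_d) : Prop :=
  [/\ rho 1%g = 1%:M,
      (forall s t, rho (s * t)%g = rho s *m rho t) &
      (forall s, rho s = 1%:M -> s = 1%g)].

Definition torus_Qpoint (L : splittingFieldType rat) (d : nat)
  (rho : gal_of {:L} -> 'M[int]_d) (h : 'rV[int]_d -> L) : Prop :=
  [/\ (forall chi psi, h (chi + psi) = h chi * h psi),
      (forall chi, h chi != 0) &
      (forall s chi, h (chi *m rho s) = s (h chi))].

Definition algint (L : fieldType) (x : L) : Prop :=
  exists p : {poly int}, p \is monic /\ root (map_poly intr p) x.

Definition nz_prime_ideal (L : fieldType) (P : L -> Prop) : Prop :=
  [/\ (forall x, P x -> algint x),
      P 0,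
      (forall x y, P x -> P y -> P (x + y)),
      (forall a x, algint a -> P x -> P (a * x)) &
      [/\ ~ P 1,
      (forall x y, algint x -> algint y -> P (x * y) -> P x \/ P y) &
      (exists x, P x /\ x != 0)]].

(* x = y mod n O_pi  (pi-adic completion), written through the localization:
   x - y lies in n O_(pi), i.e. (x - y) b = n a with a, b in O, b notin pi.
   (Since O_pi ∩ L = O_(pi), this is exactly the paper's condition.) *)
Definition congr_mod_pi (L : fieldType) (P : L -> Prop) (n : nat) (x y : L)
  : Prop :=
  exists a b : L, [/\ algint a, algint b, ~ P b & (x - y) * b = n%:R * a].

(* Main.v *)
(* A Q-point is built as
     h chi = \prod_(j, s) s(x_j) ^ (chi rho(s^-1) W)_j,
   which is Galois-equivariant for any integer matrix W and any x_j in L^*.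
   W = (1 | -1) is chosen so that every chi != 0 has a negative coordinate in
   chi W. The x_j are nonunits of O, congruent to 1 mod n, and each x_j is
   comaximal in O with all other conjugates s(x_i). If (chi W)_j < 0 and h chi
   were integral, then x_j would divide in O a product of elements comaximal
   with x_j, hence would be a unit. Comaximality thus replaces the totally split
   primes of the usual argument.
   The x_j are found one after the other as 1 + k m D a, where m is n times the
   norms of the previous ones, a is an integral generator of L, and D is divisible
   by all the s a - a with s <> 1; a suitable k exists because the norm is a
   nonconstant polynomial in k, while units have norm 1 or -1. *)
Require Import Defs.
From HB Require Import structures.
From mathcomp Require Import all_boot all_order all_algebra all_fingroup all_field.
From mathcomp Require Import ring.
Set Implicit Arguments. Unset Strict Implicit. Unset Printing Implicit Defensive.
Import GRing.Theory Num.Theory.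
Local Open Scope ring_scope.

(** * Closure properties of algebraic integers *)

Lemma algintP (L : fieldType) (x : L) : algint x <-> integralOver intr x.
Proof. by split=> [[p [? ?]]|[p ? ?]]; exists p. Qed.

Lemma algint_nat (L : fieldType) (n : nat) : algint (n%:R : L).
Proof. by apply/algintP; apply: integral_nat. Qed.

Lemma algint0 (L : fieldType) : algint (0 : L).
Proof. exact: (algint_nat L 0). Qed.

Lemma algint1 (L : fieldType) : algint (1 : L).
Proof. exact: (algint_nat L 1). Qed.

Lemma algintD (L : fieldType) (x y : L) : algint x -> algint y -> algint (x + y).
Proof. by move=> /algintP hx /algintP hy; apply/algintP; apply: integral_add. Qed.

Lemma algintN (L : fieldType) (x : L) : algint x -> algint (- x).
Proof. by move=> /algintP hx; apply/algintP; apply: integral_opp. Qed.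

Lemma algintM (L : fieldType) (x y : L) : algint x -> algint y -> algint (x * y).
Proof. by move=> /algintP hx /algintP hy; apply/algintP; apply: integral_mul. Qed.

Lemma algint_prod (L : fieldType) (I : Type) (r : seq I) (P : pred I) (F : I -> L) :
  (forall i, P i -> algint (F i)) -> algint (\prod_(i <- r | P i) F i).
Proof. by move=> hF; apply: big_ind => //; [exact: algint1 | exact: algintM]. Qed.

Lemma algintX (L : fieldType) (x : L) (n : nat) : algint x -> algint (x ^+ n).
Proof. by move=> hx; elim: n => [|n IHn]; [exact: algint1 | rewrite exprS; exact: algintM]. Qed.

Lemma algint_rmorph (K L : fieldType) (f : {rmorphism K -> L}) (x : K) :
  algint x -> algint (f x).
Proof.
case=> p [pmon px]; exists p; split=> //.
have -> : map_poly intr p = map_poly f (map_poly intr p) :> {poly L}.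
  by rewrite -map_poly_comp; apply: eq_map_poly => a; rewrite /= rmorph_int.
exact: rmorph_root.
Qed.

Ltac algint := by
  repeat first [ assumption | apply: algint0 | apply: algint1 | apply: algint_nat
               | apply: algintD | apply: algintN | apply: algintM
               | apply: algint_rmorph ].

(** * Rational elements, Galois norms and nonunits *)

Lemma numfield_intr_eq0 (L : fieldExtType rat) (z : int) :
  (z%:~R == 0 :> L) = (z == 0).
Proof. by rewrite -(rmorph_int (in_alg L)) fmorph_eq0 intr_eq0. Qed.

(** The monic equation descends from L to Q and is carried on to [algC], where rational algebraic
    integers are known to be integers. *)
Lemma algint_rat (L : fieldExtType rat) (r : rat) :
  algint (r%:A : L) -> exists z : int, r = z%:~R.
Proof.
case=> p [pmon].
have -> : map_poly intr p = map_poly (in_alg L) (map_poly intr p) :> {poly L}.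
  by rewrite -map_poly_comp; apply: eq_map_poly => a; rewrite -(rmorph_int (in_alg L)).
rewrite fmorph_root -(fmorph_root (ratr : rat -> algC)) -map_poly_comp => pr.
have intr_Aint : (ratr r : algC) \in Aint.
  apply: root_monic_Aint pr _ _; first exact: monic_map.
  by apply/polyOverP => i; rewrite coef_map /= rmorph_int rpred_int.
have /intrP[z] := Cint_rat_Aint (Crat_rat r) intr_Aint.
by rewrite -(rmorph_int (ratr : rat -> algC)) => /fmorph_inj ->; exists z.
Qed.

Lemma gal_fixed_rat (L : splittingFieldType rat) (x : L) :
  (forall s : gal_of {:L}, s x = x) -> exists r : rat, x = r%:A.
Proof.
move=> fx; have galL : galois 1 {:L}.
  rewrite /galois sub1v normalFieldf andbT /=.
  apply/separableP => y _; apply: pcharf0_separable.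
  exact: ftrans (pchar_lalg L) (pchar_num _).
have : x \in fixedField 'Gal({:L} / 1)%g by apply/fixedFieldP; rewrite ?memvf.
by rewrite (galois_fixedField galL) => /vlineP.
Qed.

Definition gal_norm (L : splittingFieldType rat) (x : L) : L :=
  \prod_(s : gal_of {:L}) s x.

Lemma gal_norm_fixed (L : splittingFieldType rat) (x : L) (t : gal_of {:L}) :
  t (gal_norm x) = gal_norm x.
Proof.
rewrite /gal_norm rmorph_prod [RHS](reindex_inj (mulIg t)) /=.
by apply: eq_bigr => s _; rewrite galM ?memvf.
Qed.

Lemma gal_norm_eq0 (L : splittingFieldType rat) (x : L) :
  (gal_norm x == 0) = (x == 0).
Proof.
apply/prodf_eq0/idP => [[s _]|/eqP->]; first by rewrite fmorph_eq0.
by exists 1%g => //; rewrite rmorph0.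
Qed.

Lemma algint_gal_norm (L : splittingFieldType rat) (x : L) :
  algint x -> algint (gal_norm x).
Proof. by move=> hx; apply: algint_prod => s _; apply: algint_rmorph. Qed.

Lemma gal_norm_conj_dvd (L : splittingFieldType rat) (x : L) (s : gal_of {:L}) :
  algint x -> exists2 y, algint y & gal_norm x = s x * y.
Proof.
move=> hx; exists (\prod_(t | t != s) t x); last by rewrite /gal_norm (bigD1 s).
by apply: algint_prod => t _; apply: algint_rmorph.
Qed.

Lemma gal_normV (L : splittingFieldType rat) (x : L) :
  gal_norm x^-1 = (gal_norm x)^-1.
Proof. by rewrite /gal_norm -prodfV; apply: eq_bigr => s _; rewrite fmorphV. Qed.

(** The norm and its inverse are both rational algebraic integers, so the norm is 1 or -1; the
    square covers both signs. *)
Lemma gal_norm_unit (L : splittingFieldType rat) (x : L) :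
  x != 0 -> algint x -> algint x^-1 -> gal_norm x ^+ 2 = 1.
Proof.
move=> x0 hx hVx.
have [r Dr] := gal_fixed_rat (gal_norm_fixed x).
have [z Dz] : exists z : int, r = z%:~R.
  by apply: (@algint_rat L); rewrite -Dr; apply: algint_gal_norm.
have [w Dw] : exists w : int, r^-1 = w%:~R.
  apply: (@algint_rat L); rewrite -[_%:A]/(in_alg L _) fmorphV /= -Dr.
  by rewrite -gal_normV; apply: algint_gal_norm.
have r0 : r != 0.
  by apply: contraNneq x0 => r0; rewrite -gal_norm_eq0 Dr r0 scale0r.
have zw : z * w = 1.
  by apply: (@intr_inj rat); rewrite rmorphM /= -Dz -Dw mulfV.
have : `|z|%N = 1%N.
  have /eqP := congr1 absz zw; rewrite abszM /= muln_eq1.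
  by case/andP=> /eqP.
move=> az; have z2 : z ^+ 2 = 1 by rewrite -real_normK ?num_real // -abszE az expr1n.
by rewrite Dr Dz -[_%:A]/(in_alg L _) -!rmorphXn /= z2 scale1r.
Qed.

(** The norm of 1 + k b is the value at k of a polynomial [Q]. As Q (Q^2 - 1) is nonzero, some
    natural number k is not a root of it, and then the norm is none of 0, 1, -1. *)
Lemma exists_nonunit (L : splittingFieldType rat) (b : L) :
  algint b -> b != 0 ->
  exists k : nat, 1 + k%:R * b != 0 /\ ~ algint (1 + k%:R * b)^-1.
Proof.
move=> hb b0.
pose Q := \prod_(s : gal_of {:L}) (1 + (s b) *: 'X) : {poly L}.
have Qk (k : nat) : Q.[k%:R] = gal_norm (1 + k%:R * b).
  rewrite horner_prod; apply: eq_bigr => s _.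
  by rewrite !hornerE rmorphD rmorph1 rmorphM rmorph_nat mulrC.
pose R := Q * (Q ^+ 2 - 1).
have R0 : R != 0.
  rewrite mulf_neq0 //.
    apply: contra_neq (oner_neq0 L) => Q0.
    by have := Qk 0%N; rewrite Q0 horner0 mul0r addr0 /gal_norm big1 // => s _;
      rewrite rmorph1.
  rewrite subr_eq0; apply: contra_neq (oner_neq0 L) => Q1.
  (* At -1/b the factor of the identity automorphism vanishes, so Q^2 takes the value 0 there, not
     1. *)
  have := congr1 (horner^~ (- b^-1)) Q1.
  rewrite horner_exp hornerC /Q (bigD1 1%g) //= gal_id hornerM !hornerE.
  by rewrite mulrN mulfV // subrr mul0r expr0n.
have [k Rk] : exists k : nat, ~~ root R k%:R.
  (* These [size R] points are distinct in characteristic 0, one more than the degree of [R]. *)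
  pose rs := [seq k%:R : L | k <- iota 0 (size R)].
  have : ~~ all (root R) rs.
    apply/negP => allR; have := max_poly_roots R0 allR.
    rewrite map_inj_uniq ?iota_uniq ?size_map ?size_iota ?ltnn; first by move/(_ isT).
    move=> i j /eqP; rewrite -subr_eq0 -[i%:R]/(i%:Z%:~R) -[j%:R]/(j%:Z%:~R) -rmorphB.
    by rewrite numfield_intr_eq0 subr_eq0 => /eqP[].
  by case/allPn => _ /mapP[k _ ->]; exists k.
have {}Rk : gal_norm (1 + k%:R * b) * (gal_norm (1 + k%:R * b) ^+ 2 - 1) != 0.
  by move: Rk; rewrite /root hornerM hornerD horner_exp hornerN hornerC Qk.
have x0 : 1 + k%:R * b != 0.
  by apply: contraNneq Rk => x0; rewrite mulf_eq0 gal_norm_eq0 x0 eqxx.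
exists k; split=> // hV.
have hN : gal_norm (1 + k%:R * b) ^+ 2 = 1 by apply: gal_norm_unit => //; algint.
by rewrite hN subrr mulr0 eqxx in Rk.
Qed.

(** * Integral multiples and an integral generator *)

(** Clearing denominators in the minimal polynomial of x gives an integer polynomial [q]; its
    leading coefficient serves as c. *)
Lemma exists_algint_multiple (L : fieldExtType rat) (x : L) :
  exists2 c : int, c != 0 & algint (c%:~R * x).
Proof.
have : integralOver (in_alg L) x.
  have /polyOver1P[p Dp] := minPolyOver 1 x.
  exists p; last by rewrite -Dp root_minPoly.
  by rewrite -(map_monic (in_alg L)) -Dp monic_minPoly.
case=> p pmon px; have [q [a a0 Dp]] := rat_poly_scale p.
have q0 : q != 0.
  apply: contraTneq pmon => q0.
  by rewrite Dp q0 rmorph0 scaler0 monicE lead_coef0 eq_sym oner_eq0.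
have {px} qx : root (map_poly intr q) x.
  have a1 : (a%:~R^-1 : rat)%:A != 0 :> L.
    by rewrite -[_%:A]/(in_alg L _) fmorph_eq0 invr_eq0 intr_eq0.
  move: px; rewrite Dp linearZ /= rootZ //.
  rewrite -map_poly_comp; congr (root _ _).
  by apply: eq_map_poly => i; rewrite -[RHS](rmorph_int (in_alg L)).
have [m Dm] : exists m, size q = m.+2.
  have : (1 < size (map_poly intr q : {poly L}))%N.
    apply: (root_size_gt1 _ qx); rewrite map_poly_eq0_id0 //.
    by rewrite numfield_intr_eq0 lead_coef_eq0.
  rewrite size_map_poly_id0 ?numfield_intr_eq0 ?lead_coef_eq0 //.
  by case: (size q) => [|[|m]] // _; exists m.
pose c := lead_coef q.
have Dc : q`_m.+1 = c by rewrite /c lead_coefE Dm.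
exists c; first by rewrite lead_coef_eq0.
(* The E i are the coefficients of the monic polynomial c ^ m * q('X / c). *)
pose E i := if i == m.+1 then 1 else q`_i * c ^+ (m - i).
exists (\poly_(i < m.+2) E i); split.
  by rewrite monicE lead_coef_poly // /E eqxx.
have -> : map_poly intr (\poly_(i < m.+2) E i) = \poly_(i < m.+2) (E i)%:~R :> {poly L}.
  by apply/polyP => i; rewrite coef_map !coef_poly; case: ifP.
apply/rootP.
suff -> : (\poly_(i < m.+2) (E i)%:~R).[c%:~R * x] =
    c%:~R ^+ m * (map_poly intr q).[x] :> L.
  by rewrite (rootP qx) mulr0.
rewrite horner_poly (@horner_coef_wide _ m.+2) ?(leq_trans (size_poly _ _)) ?Dm //.
rewrite mulr_sumr; apply: eq_bigr => i _; rewrite coef_map /E /=.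
case: eqP => [->|/eqP im]; first by rewrite Dc exprMn exprS; ring.
have le_im : (i <= m)%N by rewrite -ltnS ltn_neqAle im -ltnS ltn_ord.
have -> : c%:~R ^+ m = c%:~R ^+ (m - i) * c%:~R ^+ i :> L by rewrite -exprD subnK.
by rewrite rmorphM rmorphXn exprMn /=; ring.
Qed.

(** An integral multiple of a primitive element works: an automorphism that fixes it fixes all of
    L. *)
Lemma exists_integral_generator (L : splittingFieldType rat) :
  exists a : L, [/\ algint a, a != 0 & forall s : gal_of {:L}, s != 1%g -> s a != a].
Proof.
pose g := separable_generator 1 {:L}.
have [c c0 hc] := exists_algint_multiple g.
have fix_g (s : gal_of {:L}) : s (c%:~R * g) = c%:~R * g -> s = 1%g.
  rewrite rmorphM rmorph_int => /mulfI sg.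
  have {}sg : s g = g by apply: sg; rewrite numfield_intr_eq0.
  have DL : {:L}%VS = <<1; g>>%VS :> {vspace L}.
    apply: eq_adjoin_separable_generator; rewrite ?sub1v //.
    apply/separableP => y _; apply: pcharf0_separable.
    exact: ftrans (pchar_lalg L) (pchar_num _).
  apply/eqP/gal_eqP => y _; rewrite gal_id.
  have : y \in <<1; g>>%VS by rewrite -DL memvf.
  case/Fadjoin_polyP => p /polyOver1P[q ->] ->.
  rewrite -horner_map -map_poly_comp /= sg; congr (_.[_]).
  by apply: eq_map_poly => r /=; rewrite linearZ /= rmorph1.
(* If this multiple is 0, every automorphism fixes it, so the Galois group is trivial and 1
   serves. *)
have [ca0|ca0] := eqVneq (c%:~R * g) 0.
  exists 1; split; try algint; first exact: oner_neq0.
  by move=> s /eqP[]; apply: fix_g; rewrite ca0 rmorph0.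
by exists (c%:~R * g); split=> // s; apply: contra_neq; apply: fix_g.
Qed.

(** * Comaximality *)

(** Bezout form of x O + a O = O, for integral x and a. *)
Definition comax (L : fieldType) (x a : L) : Prop :=
  exists u v, [/\ algint u, algint v & u * a + v * x = 1].

Lemma comax1 (L : fieldType) (x : L) : comax x 1.
Proof. by exists 1, 0; split; try algint; rewrite mulr1 mul0r addr0. Qed.

Lemma comaxM (L : fieldType) (x a b : L) :
  algint a -> comax x a -> comax x b -> comax x (a * b).
Proof.
move=> ha [u [v [hu hv uv]]] [u' [v' [hu' hv' uv']]].
exists (u * u'), (u * a * v' + v); split; try algint.
by rewrite -[RHS]uv -[a in RHS]mulr1 -uv'; ring.
Qed.

Lemma comax_prod (L : fieldType) (x : L) (I : Type) (r : seq I) (P : pred I) (F : I -> L) :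
  (forall i, P i -> algint (F i)) -> (forall i, P i -> comax x (F i)) ->
  comax x (\prod_(i <- r | P i) F i).
Proof.
move=> hF cF.
suff [] : algint (\prod_(i <- r | P i) F i) /\ comax x (\prod_(i <- r | P i) F i) by [].
apply: (big_ind (fun y => algint y /\ comax x y)) => [|a b [ha ca] [hb cb]|i Pi];
  last by split; [exact: hF|exact: cF].
  by split; [algint|exact: comax1].
by split; [algint|exact: comaxM].
Qed.

Lemma comaxX (L : fieldType) (x a : L) (n : nat) :
  algint a -> comax x a -> comax x (a ^+ n).
Proof.
move=> ha ca; elim: n => [|n IHn]; first exact: comax1.
by rewrite exprS; apply: comaxM.
Qed.

Lemma comax_dvd (L : fieldType) (x a b : L) :
  algint b -> comax x (a * b) -> comax x a.
Proof.
move=> hb [u [v [hu hv uv]]]; exists (u * b), v; split; try algint.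
by rewrite -uv; ring.
Qed.

Lemma comax_cong1 (L : fieldType) (m c : L) : algint c -> comax (1 + m * c) m.
Proof. by move=> hc; exists (- c), 1; split; try algint; ring. Qed.

Lemma comax_cong1_sym (L : fieldType) (x m c : L) :
  algint m -> algint c -> comax x (1 + (x * m) * c).
Proof. by move=> hm hc; exists 1, (- (m * c)); split; try algint; ring. Qed.

(** * Nonunits comaximal with their conjugates and with each other *)

(** For x = 1 + m k D a with m and D fixed by Galois, s x - x = m k D (s a - a). Now x is comaximal
    with m k D, being 1 modulo it, and with s a - a, a divisor of D; hence with s x - x, and so with
    s x. *)
Lemma exists_split_nonunit (L : splittingFieldType rat) (m : L) :
  algint m -> m != 0 -> (forall s : gal_of {:L}, s m = m) ->
  exists2 z, algint z &
    [/\ 1 + m * z != 0, ~ algint (1 + m * z)^-1 &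
        forall s : gal_of {:L}, s != 1%g -> comax (1 + m * z) (s (1 + m * z))].
Proof.
move=> hm m0 fm; have [a [ha a0 fa]] := exists_integral_generator L.
(* Taking norms makes [D] Galois-invariant while each s a - a still divides it. *)
pose D := \prod_(s : gal_of {:L} | s != 1%g) gal_norm (s a - a).
have hda (s : gal_of {:L}) : algint (s a - a) by algint.
have hD : algint D by apply: algint_prod => s _; exact: algint_gal_norm (hda s).
have D0 : D != 0.
  by apply/prodf_neq0 => s s1; rewrite gal_norm_eq0 subr_eq0 fa.
have fD (t : gal_of {:L}) : t D = D.
  by rewrite rmorph_prod; apply: eq_bigr => s _; apply: gal_norm_fixed.
have [||k [x0 xV]] := @exists_nonunit L (m * D * a); [by algint|by rewrite !mulf_neq0|].
have Dx : 1 + k%:R * (m * D * a) = 1 + m * (k%:R * D * a) by ring.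
rewrite Dx in x0 xV; exists (k%:R * D * a); first by algint.
split=> // s s1; set x := 1 + _.
have cxm : comax x (m * k%:R * D).
  have -> : x = 1 + (m * k%:R * D) * a by rewrite /x; ring.
  exact: comax_cong1.
have cxa : comax x (s a - a).
  have [w hw Dw] := gal_norm_conj_dvd 1%g (hda s); rewrite gal_id in Dw.
  have hP : algint (\prod_(t : gal_of {:L} | (t != 1%g) && (t != s)) gal_norm (t a - a)).
    by apply: algint_prod => t _; exact: algint_gal_norm (hda t).
  have : comax x D by apply: (@comax_dvd _ _ _ (m * k%:R)); [algint|rewrite mulrC].
  by rewrite /D (bigD1 s) //= Dw -mulrA; apply: comax_dvd; algint.
have sx : s x - x = (m * k%:R * D) * (s a - a).
  by rewrite /x rmorphD rmorph1 !rmorphM rmorph_nat /= fm fD; ring.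
have hmkD : algint (m * k%:R * D) by algint.
have [u [v [hu hv uv]]] := comaxM hmkD cxm cxa.
exists u, (v - u); split; [by []|by algint|].
by rewrite -uv -sx mulrBl mulrBr addrA addrAC.
Qed.

(** By induction: the new element is 1 modulo n p, where p is the product of the norms of the
    earlier ones and so is divisible by all their conjugates. *)
Lemma exists_coprime_nonunits (L : splittingFieldType rat) (n m : nat) :
  (0 < n)%N -> exists x : nat -> L,
    [/\ forall i, (i < m)%N -> exists2 z, algint z & x i = 1 + n%:R * z,
        forall i, (i < m)%N -> x i != 0 /\ ~ algint (x i)^-1 &
        forall (i j : nat) (s : gal_of {:L}), (i < m)%N -> (j < m)%N ->
          (i != j) || (s != 1%g) -> comax (x i) (s (x j))].
Proof.
move=> n_gt0; elim: m => [|m [x [cong_x nonunit_x comax_x]]]; first by exists (fun=> 1).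
have hx i : (i < m)%N -> algint (x i).
  by move=> /cong_x[z hz ->]; algint.
pose p : L := \prod_(i < m) gal_norm (x i).
have hp : algint p by apply: algint_prod => i _; apply/algint_gal_norm/hx.
have fp (s : gal_of {:L}) : s p = p.
  by rewrite rmorph_prod; apply: eq_bigr => i _; apply: gal_norm_fixed.
have dvd_p i (s : gal_of {:L}) : (i < m)%N -> exists2 w, algint w & p = s (x i) * w.
  move=> lt_im; have [w hw Dw] := gal_norm_conj_dvd s (hx i lt_im).
  exists (w * \prod_(j < m | j != Ordinal lt_im) gal_norm (x j)).
    by apply: algintM => //; apply: algint_prod => j _; apply/algint_gal_norm/hx.
  by rewrite /p (bigD1 (Ordinal lt_im)) //= Dw mulrA.
have [|||z hz [y0 yV comax_y]] := @exists_split_nonunit L (n%:R * p).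
- by algint.
- rewrite mulf_neq0 //.
    by rewrite -[n%:R]/(n%:Z%:~R) numfield_intr_eq0 -lt0n.
  by apply/prodf_neq0 => i _; rewrite gal_norm_eq0; case: (nonunit_x i).
- by move=> s; rewrite rmorphM rmorph_nat /= fp.
set y := 1 + n%:R * p * z in y0 yV comax_y.
exists (fun i => if i == m then y else x i); split.
- move=> i; rewrite ltnS leq_eqVlt; case: eqP => [_ _|_ /cong_x //].
  by exists (p * z); [algint | rewrite /y; ring].
- by move=> i; rewrite ltnS leq_eqVlt; case: eqP => [_ _|_ /nonunit_x].
have ltSP i : (i < m.+1)%N -> i = m \/ (i != m) && (i < m)%N.
  by rewrite ltnS leq_eqVlt; case: eqVneq => [->|_] /= lt_im; [left | right].
(* The cases in order: both elements new, only the first new, only the second new, both old. *)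
move=> i j s /ltSP[->|/andP[/negPf-> lt_im]] /ltSP[->|/andP[/negPf-> lt_jm]];
  rewrite ?eqxx.
- exact: comax_y.
- have [w hw Dw] := dvd_p j s lt_jm => _; apply: (comax_dvd hw).
  rewrite -Dw; apply: (@comax_dvd _ _ _ n%:R); first by algint.
  by rewrite mulrC; apply: comax_cong1.
- have [w hw Dw] := dvd_p i 1%g lt_im => _; rewrite gal_id in Dw.
  (* Since p is Galois-invariant, s y is again 1 modulo p, hence modulo [x i]. *)
  have -> : s y = 1 + x i * (n%:R * w) * s z.
    by rewrite /y rmorphD rmorph1 !rmorphM rmorph_nat /= fp Dw !mulrA [x i * _]mulrC.
  by apply: comax_cong1_sym; algint.
- exact: comax_x.
Qed.

(** * Products of integer powers as fractions *)

(** Positive part of an exponent, with the negative part next; [Negz k] stands for -(k + 1). *)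
Definition exprz_num (e : int) : nat := if e is Posz k then k else 0.
Definition exprz_den (e : int) : nat := if e is Negz k then k.+1 else 0.

Lemma prod_exprz_frac (L : fieldType) (I : finType) (a : I -> L) (e : I -> int) :
  \prod_i a i ^ e i =
  (\prod_i a i ^+ exprz_num (e i)) / \prod_i a i ^+ exprz_den (e i).
Proof.
rewrite -prodfV -big_split; apply: eq_bigr => i _ /=.
by case: (e i) => k; rewrite /= ?expr0 ?invr1 ?mulr1 ?mul1r.
Qed.

(** If the product were integral, [a i0], which divides the denominator, would divide the numerator.
    It is comaximal with the numerator, so it would be a unit. *)
Lemma prod_exprz_not_algint (L : fieldType) (I : finType) (a : I -> L)
    (e : I -> int) (i0 : I) :
  (forall i, algint (a i)) -> (forall i, a i != 0) -> ~ algint (a i0)^-1 ->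
  (forall i, i != i0 -> comax (a i0) (a i)) -> e i0 < 0 ->
  ~ algint (\prod_i a i ^ e i).
Proof.
move=> ha a0 nVa ca; case De0: (e i0) => [//|k] _ hy; apply: nVa.
have cnum : comax (a i0) (\prod_i a i ^+ exprz_num (e i)).
  apply: comax_prod => i _; first exact: algintX.
  have [->|ne_i] := eqVneq i i0; first by rewrite De0; apply: comax1.
  by apply: comaxX => //; apply: ca.
have den0 : \prod_i a i ^+ exprz_den (e i) != 0.
  by apply/prodf_neq0 => i _; rewrite expf_neq0.
(* The numerator divided by [a i0]: one of the k + 1 factors [a i0] of the denominator is
   removed. *)
pose w := a i0 ^+ k * (\prod_(i | i != i0) a i ^+ exprz_den (e i)) * \prod_i a i ^ e i.
have Dnum : \prod_i a i ^+ exprz_num (e i) = a i0 * w.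
  transitivity ((\prod_i a i ^ e i) * \prod_i a i ^+ exprz_den (e i)).
    by rewrite prod_exprz_frac divfK.
  by rewrite (bigD1 (F := fun i => a i ^+ _) i0) //= De0 /= exprS /w; ring.
have hw : algint w.
  apply: algintM hy; apply: algintM; first exact: algintX.
  by apply: algint_prod => i _; apply: algintX.
have [u [v [hu hv]]] := cnum; rewrite Dnum => uv.
have -> : (a i0)^-1 = u * w + v.
  by apply: (mulfI (a0 i0)); rewrite mulfV // -uv; ring.
by algint.
Qed.

Lemma prod_cong1 (L : fieldType) (m : L) (I : finType) (a : I -> L) (e : I -> nat) :
  algint m -> (forall i, exists2 z, algint z & a i = 1 + m * z) ->
  exists2 z, algint z & \prod_i a i ^+ e i = 1 + m * z.
Proof.
move=> hm ha.
have cong1 : exists2 z, algint z & 1 = 1 + m * z.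
  by exists 0; [algint | rewrite mulr0 addr0].
have congM b c : (exists2 z, algint z & b = 1 + m * z) ->
    (exists2 z, algint z & c = 1 + m * z) -> exists2 z, algint z & b * c = 1 + m * z.
  by move=> [z hz ->] [w hw ->]; exists (z + w + m * z * w); [algint | ring].
apply: (big_ind (fun y => exists2 z, algint z & y = 1 + m * z)) => // i _.
elim: (e i) => [|k IHk]; first by rewrite expr0.
by rewrite exprS; apply: congM.
Qed.

(** Numerator and denominator are both 1 modulo n, so their difference lies in n O; a denominator in
    P would force 1 into P. *)
Lemma prod_exprz_congr_mod_pi (L : fieldType) (n : nat) (I : finType)
    (a : I -> L) (e : I -> int) (P : L -> Prop) :
  (forall i, a i != 0) ->
  (forall i, exists2 z, algint z & a i = 1 + n%:R * z) ->
  nz_prime_ideal P -> P n%:R -> congr_mod_pi P n (\prod_i a i ^ e i) 1.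
Proof.
move=> a0 ha [_ _ PD PM [nP1 _ _]] Pn.
have hn : algint (n%:R : L) by algint.
have [z hz Dnum] := prod_cong1 (fun i => exprz_num (e i)) hn ha.
have [w hw Dden] := prod_cong1 (fun i => exprz_den (e i)) hn ha.
have den0 : \prod_i a i ^+ exprz_den (e i) != 0.
  by apply/prodf_neq0 => i _; rewrite expf_neq0.
exists (z - w), (1 + n%:R * w); split; try algint.
  move=> Pden; apply: nP1; have -> : 1 = (1 + n%:R * w) + (- w) * n%:R :> L by ring.
  by apply: PD => //; apply: PM => //; algint.
rewrite prod_exprz_frac -Dden mulrBl divfK // Dnum Dden; ring.
Qed.

(** * Construction of the rational point *)

Theorem theorem1 (L : splittingFieldType rat) (d : nat)
  (rho : gal_of {:L} -> 'M[int]_d) (hrho : gal_rep rho)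
  (n : nat) (hn : (0 < n)%N) :
  exists h : 'rV[int]_d -> L,
    [/\ torus_Qpoint rho h,
        (forall chi : 'rV[int]_d, chi != 0 -> ~ algint (h chi)) &
        (forall (chi : 'rV[int]_d) (P : L -> Prop),
            nz_prime_ideal P -> P n%:R -> congr_mod_pi P n (h chi) 1)].
Proof.
have [rho1 rhoM _] := hrho.
have [x [cong_x nonunit_x comax_x]] := exists_coprime_nonunits L (d + d) hn.
pose a (k : 'I_(d + d) * gal_of {:L}) := k.2 (x k.1).
pose W : 'M[int]_(d, d + d) := row_mx 1%:M (- 1%:M).
pose e (chi : 'rV[int]_d) (k : 'I_(d + d) * gal_of {:L}) :=
  (chi *m rho k.2^-1%g *m W) 0 k.1.
have cong_a k : exists2 z, algint z & a k = 1 + n%:R * z.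
  case: k => j s; have [z hz Dx] := cong_x j (ltn_ord j).
  by exists (s z); [algint | rewrite /a Dx rmorphD rmorph1 rmorphM rmorph_nat].
have ha k : algint (a k) by have [z hz ->] := cong_a k; algint.
have a0 k : a k != 0 by rewrite fmorph_eq0; case: (nonunit_x k.1).
exists (fun chi => \prod_k a k ^ e chi k); split; last first.
- by move=> chi P hP Pn; apply: prod_exprz_congr_mod_pi.
- move=> chi chi0.
  have [j chi_j] : exists j, (chi *m W) 0 j < 0.
    have [i chi_i] : exists i, chi 0 i != 0 by apply/rV0Pn.
    rewrite mul_mx_row mulmxN mulmx1.
    case: (ltrgtP (chi 0 i) 0) => [lt_i|gt_i|/eqP]; last by rewrite (negPf chi_i).
      by exists (lshift d i); rewrite row_mxEl.
    by exists (rshift d i); rewrite row_mxEr mxE oppr_lt0.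
  (* At the identity automorphism the exponent is (chi W)_j itself, which is negative. *)
  apply: (@prod_exprz_not_algint _ _ a _ (j, 1%g)) => //.
  + by rewrite /a gal_id; case: (nonunit_x j).
  + case=> i s; rewrite xpair_eqE negb_and /a /= gal_id => ne_ij.
    by apply: comax_x => //; rewrite eq_sym.
  + by rewrite /e /= invg1 rho1 mulmx1.
split.
- move=> chi psi; rewrite -big_split; apply: eq_bigr => k _ /=.
  by rewrite /e !mulmxDl mxE expfzDr.
- by move=> chi; apply/prodf_neq0 => k _; exact/expfz_neq0/a0.
move=> t chi; rewrite rmorph_prod.
(* Replacing s by s t turns the base into t (s x_j), and the exponent simplifies by rho(t) rho((s
   t)^-1) = rho(s^-1). *)
rewrite (reindex_inj (h := fun k => (k.1, (k.2 * t)%g))) /=; last first.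
  by move=> [i s] [j r] /= /eqP; rewrite xpair_eqE => /andP[/eqP-> /eqP/mulIg->].
apply: eq_bigr => -[i s] _; rewrite rmorphXz ?unitfE ?a0 // /e /a /=.
by rewrite galM ?memvf // -(mulmxA chi) -rhoM invMg mulgA mulgV mul1g.
Qed.
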